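(* The elliptic curve $$6(u^{12}-33u^8-33u^4+1)\,y^2=x^3-x$$ over $\mathbb{Q}(u)$ has rank at least $3$, with independent points $$P_1=\Bigl(-\frac{u^4-6u^2+1}{3(u^2+1)^2},\ \frac{2}{9(u^2+1)^3}\Bigr),\quad P_2=\Bigl(-\frac{u^4+6u^2+1}{3(u^2-1)^2},\ \frac{2}{9(u^2-1)^3}\Bigr),\quad P_3=\Bigl(\frac{u^4+1}{6u^2},\ \frac{1}{36u^3}\Bigr).$$ *)

(* Defs.v *)
From HB Require Import structures.
From mathcomp Require Import all_boot all_order all_algebra.
From mathcomp Require Import ring.

Set Implicit Arguments.
Unset Strict Implicit.
Unset Printing Implicit Defensive.

Import GRing.Theory.
Local Open Scope ring_scope.

(* The elliptic curve  d y^2 = x^3 + a x + b  over a field of characteristic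
   different from 2: the quadratic twist by d of a short Weierstrass curve.
   The conditions say exactly that its projective closure is smooth. *)
Record ellcurve (F : fieldType) := EllCurve {
  ec_d : F;
  ec_a : F;
  ec_b : F;
  ec_smooth : [&& 2 != 0 :> F, ec_d != 0 & 4 * ec_a ^+ 3 + 27 * ec_b ^+ 2 != 0]
}.

Section Points.
Variables (F : fieldType) (E : ellcurve F).

(* [None] is the point at infinity O, [Some (x, y)] an affine point. *)
Definition on_curve (p : option (F * F)) : bool :=
  if p is Some (x, y) then ec_d E * y ^+ 2 == x ^+ 3 + ec_a E * x + ec_b E
  else true.

(* Slope of the chord through (x1, y1) and (x2, y2), or of the tangent when
   x1 = x2; the tangent is only used when the two points coincide and y1 != 0. *)
Definition ec_slope (x1 y1 x2 y2 : F) : F :=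
  if x1 == x2 then (3 * x1 ^+ 2 + ec_a E) / (2 * ec_d E * y1)
  else (y2 - y1) / (x2 - x1).

(* With y = l x + m the secant line, the three abscissae of its intersection
   with the curve sum to d l^2. *)
Definition add_raw (p q : option (F * F)) : option (F * F) :=
  match p, q with
  | None, _ => q
  | _, None => p
  | Some (x1, y1), Some (x2, y2) =>
    if (x1 == x2) && (y1 == - y2) then None else
    let l := ec_slope x1 y1 x2 y2 in
    let x3 := ec_d E * l ^+ 2 - x1 - x2 in
    Some (x3, l * (x1 - x3) - y1)
  end.

Definition opp_raw (p : option (F * F)) : option (F * F) :=
  if p is Some (x, y) then Some (x, - y) else None.

Lemma on_curve_add p q : on_curve p -> on_curve q -> on_curve (add_raw p q).
Proof.
have /and3P[nz2 nzd _] := ec_smooth E.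
case: p q => [[x1 y1]|] [[x2 y2]|] //= /eqP h1 /eqP h2.
have [xeq|xne] := eqVneq x1 x2; rewrite /ec_slope /=; last first.
  rewrite (negPf xne) /=; apply/eqP.
  have nz : x2 - x1 != 0 by rewrite subr_eq0 eq_sym.
  have eb : ec_b E = ec_d E * y1 ^+ 2 - x1 ^+ 3 - ec_a E * x1.
    by rewrite h1; ring.
  have ea : ec_a E = (ec_d E * (y2 ^+ 2 - y1 ^+ 2) - (x2 ^+ 3 - x1 ^+ 3)) / (x2 - x1).
    apply: (mulIf nz); rewrite divfK //.
    by rewrite [ec_d E * _]mulrBr h1 h2; ring.
  by rewrite eb ea; field.
case: eqVneq => [//|yne].
rewrite -xeq eqxx /=.
have ey : y1 = y2.
  have : (y1 - y2) * (y1 + y2) = 0.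
    apply: (mulfI nzd); rewrite mulr0 -subr_sqr mulrBr h1 h2 xeq; ring.
  move/eqP; rewrite mulf_eq0 subr_eq0 addr_eq0 (negPf yne) orbF.
  by move/eqP.
have nzy : y1 != 0.
  apply: contraNneq yne => y0.
  by rewrite -ey y0 oppr0.
apply/eqP.
have eb : ec_b E = ec_d E * y1 ^+ 2 - x1 ^+ 3 - ec_a E * x1.
  by rewrite h1; ring.
rewrite eb; field.
by rewrite nzy nzd nz2.
Qed.

Lemma on_curve_opp p : on_curve p -> on_curve (opp_raw p).
Proof. by case: p => [[x y]|] //=; rewrite sqrrN. Qed.

Definition ec_point := {p : option (F * F) | on_curve p}.

Definition ec_zero : ec_point := exist on_curve None isT.

Definition ec_add (p q : ec_point) : ec_point :=
  exist on_curve _ (on_curve_add (valP p) (valP q)).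

Definition ec_opp (p : ec_point) : ec_point :=
  exist on_curve _ (on_curve_opp (valP p)).

Definition ec_mulz (n : int) (p : ec_point) : ec_point :=
  match n with
  | Posz k => iter k (ec_add p) ec_zero
  | Negz k => ec_opp (iter k.+1 (ec_add p) ec_zero)
  end.

Definition ec_independent (r : nat) (P : r.-tuple ec_point) : Prop :=
  forall n : 'I_r -> int,
    \big[ec_add/ec_zero]_(i < r) ec_mulz (n i) (tnth P i) = ec_zero ->
    forall i, n i = 0.

(* The rank of E(F) is the supremum of the sizes of its Z-independent
   families. *)
Definition ec_rank_ge (r : nat) : Prop :=
  exists P : r.-tuple ec_point, ec_independent P.

End Points.

Definition Qu : fieldType := {fraction {poly rat}}.

Definition u : Qu := tofrac 'X.

Definition twist : Qu := 6 * (u ^+ 12 - 33 * u ^+ 8 - 33 * u ^+ 4 + 1).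

Lemma natr_Qu_neq0 (n : nat) : n.+1%:R != 0 :> Qu.
Proof.
rewrite -(rmorph_nat (@tofrac {poly rat})) tofrac_eq0 -polyC_natr polyC_eq0.
by rewrite Num.Theory.pnatr_eq0.
Qed.

Lemma twist_neq0 : twist != 0.
Proof.
have twistE (R S : comNzRingType) (f : {rmorphism R -> S}) (x : R) :
    f x ^+ 12 - 33 * f x ^+ 8 - 33 * f x ^+ 4 + 1 =
    f (x ^+ 12 - 33 * x ^+ 8 - 33 * x ^+ 4 + 1).
  by rewrite !(rmorphB, rmorphD, rmorphM, rmorphXn, rmorph_nat, rmorph1).
have twist0 (R : comNzRingType) (c : {poly R}) :
    ('X^12 - c * 'X^8 - c * 'X^4 + 1).[0] = 1.
  by rewrite !hornerE !expr0n /= !mulr0 !subr0 add0r.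
rewrite /twist /u twistE mulf_neq0 ?natr_Qu_neq0 //.
rewrite tofrac_eq0; apply/eqP => /(congr1 (horner^~ 0)).
by rewrite twist0 horner0 => /eqP; rewrite oner_eq0.
Qed.

Lemma twist_curve_smooth :
  [&& 2 != 0 :> Qu, twist != 0 & 4 * (-1) ^+ 3 + 27 * 0 ^+ 2 != 0 :> Qu].
Proof.
apply/and3P; split; [exact: natr_Qu_neq0 | exact: twist_neq0 |].
have -> (R : comNzRingType) : 4 * (-1) ^+ 3 + 27 * 0 ^+ 2 = - 4 :> R by ring.
by rewrite oppr_eq0; exact: natr_Qu_neq0.
Qed.

Definition twist_curve : ellcurve Qu :=
  @EllCurve Qu twist (-1) 0 twist_curve_smooth.

(* Main.v *)
(* For a point P = (x, y) of d y^2 = x^3 - x over Q(u), put w(P) = x'/y, where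
   ' = d/du: up to a factor sqrt d this is the pullback along P of the
   invariant differential dx/y of the constant curve y^2 = x^3 - x, so w is a
   homomorphism to (Q(u), +).  Since w(P1) = 24 (u - u^3),
   w(P2) = 24 (u + u^3) and w(P3) = 12 (u^4 - 1) are linearly independent
   over Q, so are P1, P2, P3 over Z. *)
Require Import Defs.
From mathcomp Require Import all_boot all_order all_algebra.
From mathcomp Require Import ring lra.

Set Implicit Arguments.
Unset Strict Implicit.
Unset Printing Implicit Defensive.

Import GRing.Theory.
Local Open Scope ring_scope.

(** * Derivations of a field *)

Record derivation (F : fieldType) := Derivation {
  der :> F -> F;
  derD : forall x y, der (x + y) = der x + der y;
  derM : forall x y, der (x * y) = der x * y + x * der y
}.

Section DerivationTheory.
Variables (F : fieldType) (D : derivation F).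

Lemma der0 : D 0 = 0.
Proof. by apply: (addrI (D 0)); rewrite -derD !addr0. Qed.

Lemma derN x : D (- x) = - D x.
Proof. by apply: (addrI (D x)); rewrite -derD !subrr der0. Qed.

Lemma derB x y : D (x - y) = D x - D y.
Proof. by rewrite derD derN. Qed.

Lemma der1 : D 1 = 0.
Proof. by apply: (addrI (D 1)); rewrite -{3}[1]mulr1 derM mulr1 mul1r addr0. Qed.

Lemma der_nat n : D n%:R = 0.
Proof. by elim: n => [|n IHn]; rewrite ?der0 // mulrS derD IHn der1 addr0. Qed.

Lemma derX x n : D (x ^+ n) = n%:R * x ^+ n.-1 * D x.
Proof.
elim: n => [|[|n] IHn]; first by rewrite expr0 der1 !mul0r.
  by rewrite expr1 expr0 !mul1r.
by rewrite exprS derM IHn /= -[n.+2]addn1 natrD exprS; ring.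
Qed.

Lemma der_div x y : y != 0 -> D (x / y) = (D x - x / y * D y) / y.
Proof.
move=> y0; apply: (mulIf y0); rewrite divfK //.
by apply: (addIr (x / y * D y)); rewrite subrK -derM divfK.
Qed.

End DerivationTheory.

(** * Additivity of the invariant differential along points of the curve *)

Section InvariantDifferential.
Variables (F : fieldType) (E : ellcurve F) (D : derivation F).
Hypotheses (Da : D (ec_a E) = 0) (Db : D (ec_b E) = 0).
Local Notation a := (ec_a E).
Local Notation b := (ec_b E).
Local Notation d := (ec_d E).

(* w = D x / y for p = (x, y).  The second equation follows from the first by
   differentiating the equation of the curve when y != 0, and determines w
   when y = 0; the pair makes sense uniformly and needs no division by y. *)
Definition differential_at (p : option (F * F)) (w : F) : Prop :=
  if p is Some (x, y) then
    D x = w * y /\ (3 * x ^+ 2 + a) * w = D d * y + 2 * d * D y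
  else w = 0.

Let nz2 : 2 != 0 :> F. Proof. by case/and3P: (ec_smooth E). Qed.
Let nzd : d != 0. Proof. by case/and3P: (ec_smooth E). Qed.

Lemma differential_at_affine x y w :
  on_curve E (Some (x, y)) -> y != 0 -> D x = w * y ->
  differential_at (Some (x, y)) w.
Proof.
move=> /eqP h y0 Dx; split=> //; apply: (mulIf y0).
have /(congr1 D) := h.
rewrite !derD [D (d * _)]derM [D (a * _)]derM Da Db !derX /= Dx => e.
have -> : (D d * y + 2 * d * D y) * y = D d * y ^+ 2 + d * (2 * y ^+ 1 * D y).
  by ring.
by rewrite e; ring.
Qed.

(** A point with [y = 0] lies over a root of the cubic. If the derivative vanished there too, the
    root would be double, with [a = - 3 x^2] and [b = 2 x^3], and [4 a^3 + 27 b^2] would be zero. *)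
Lemma smooth_at_y0 x y : on_curve E (Some (x, y)) -> y = 0 ->
  3 * x ^+ 2 + a != 0.
Proof.
have /and3P[_ _] := ec_smooth E.
move=> sm /eqP h y0; apply: contraNneq sm => e.
have ea : a = - (3 * x ^+ 2) by apply/eqP; rewrite -addr_eq0 addrC e.
have eb : b = 2 * x ^+ 3.
  have -> : b = d * y ^+ 2 - x ^+ 3 - a * x by rewrite h; ring.
  by rewrite y0 ea; ring.
by rewrite ea eb; apply/eqP; ring.
Qed.

Lemma differential_at_opp p w :
  differential_at p w -> differential_at (opp_raw p) (- w).
Proof.
case: p => [[x y]|] /= => [[h1 h2]|->]; last by rewrite oppr0.
by rewrite derN h1 !mulrN h2; split; ring.
Qed.

(** This makes w a function of the point. Addition relies on it where two points are opposite or
    coincide and their differentials have to be compared. *)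
Lemma differential_at_uniq p w1 w2 : on_curve E p ->
  differential_at p w1 -> differential_at p w2 -> w1 = w2.
Proof.
case: p => [[x y]|] /= => [pE [h1 h2] [h3 h4]|_ -> ->//].
have [y0|y0] := eqVneq y 0.
  by apply: (mulfI (smooth_at_y0 pE y0)); rewrite h2 h4.
by apply: (mulIf y0); rewrite -h1.
Qed.

(** The hypotheses express the derivatives of all four coordinates through [w1], [w2], [D d] and the
    coordinates. Once [a] is eliminated, both equations at the sum are rational identities in free
    variables. *)
Lemma differential_at_chord x1 y1 x2 y2 w1 w2 :
  on_curve E (Some (x1, y1)) -> on_curve E (Some (x2, y2)) -> x1 != x2 ->
  differential_at (Some (x1, y1)) w1 -> differential_at (Some (x2, y2)) w2 ->
  differential_at (add_raw E (Some (x1, y1)) (Some (x2, y2))) (w1 + w2).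
Proof.
move=> /eqP e1 /eqP e2 x12 [Dx1 t1] [Dx2 t2].
rewrite /= /ec_slope (negPf x12) /=.
have nz : x2 - x1 != 0 by rewrite subr_eq0 eq_sym.
have Dy1 : D y1 = ((3 * x1 ^+ 2 + a) * w1 - D d * y1) / (2 * d).
  by rewrite t1; field; rewrite nzd nz2.
have Dy2 : D y2 = ((3 * x2 ^+ 2 + a) * w2 - D d * y2) / (2 * d).
  by rewrite t2; field; rewrite nzd nz2.
(* Subtracting the two curve equations eliminates [b] and leaves an equation linear in [a]. *)
have ea : a = (d * (y2 ^+ 2 - y1 ^+ 2) - (x2 ^+ 3 - x1 ^+ 3)) / (x2 - x1).
  by apply: (mulIf nz); rewrite divfK // [d * _]mulrBr e1 e2; ring.
set l := (y2 - y1) / (x2 - x1).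
have Dl : D l = (D y2 - D y1 - l * (D x2 - D x1)) / (x2 - x1).
  by rewrite der_div // !derB.
set x3 := d * l ^+ 2 - x1 - x2; set y3 := l * (x1 - x3) - y1.
have Dx3 : D x3 = (w1 + w2) * y3.
  rewrite /x3 !derB [D (d * _)]derM derX Dl Dx1 Dx2 Dy1 Dy2 ea /y3 /x3 /l; field.
  by rewrite nz nzd nz2.
split=> //.
rewrite /y3 derB derM derB Dx3 Dl Dx1 Dx2 Dy1 Dy2 ea /y3 /x3 /l; field.
by rewrite nz nzd nz2.
Qed.

(** The same elimination as for a chord, with [a] kept as a free variable. The condition [y != - y]
    selects the doubling branch of [add_raw]. *)
Lemma differential_at_tangent x y w :
  y != 0 -> y != - y -> differential_at (Some (x, y)) w ->
  differential_at (add_raw E (Some (x, y)) (Some (x, y))) (w + w).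
Proof.
move=> y0 yN [Dx t].
rewrite /= /ec_slope eqxx (negPf yN) /=.
have nz : 2 * d * y != 0 by rewrite !mulf_neq0.
have Dy : D y = ((3 * x ^+ 2 + a) * w - D d * y) / (2 * d).
  by rewrite t; field; rewrite nzd nz2.
set l := (3 * x ^+ 2 + a) / (2 * d * y).
(* Quotient rule for the tangent slope; the numerator contributes only [6 * x * D x] because
   [D a = 0]. *)
have Dl : D l = (6 * x * D x - l * (2 * D d * y + 2 * d * D y)) / (2 * d * y).
  rewrite der_div // derD Da [D (3 * _)]derM [D (2 * d * y)]derM.
  by rewrite [D (2 * d)]derM !der_nat derX -/l; congr (_ / _); ring.
set x3 := d * l ^+ 2 - x - x; set y3 := l * (x - x3) - y.
have Dx3 : D x3 = (w + w) * y3.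
  rewrite /x3 !derB [D (d * _)]derM derX Dl Dx Dy /y3 /x3 /l; field.
  by rewrite y0 nzd nz2.
split=> //.
rewrite /y3 derB derM derB Dx3 Dl Dx Dy /y3 /x3 /l; field.
by rewrite y0 nzd nz2.
Qed.

Lemma differential_at_add p1 p2 w1 w2 : on_curve E p1 -> on_curve E p2 ->
  differential_at p1 w1 -> differential_at p2 w2 ->
  differential_at (add_raw E p1 p2) (w1 + w2).
Proof.
case: p1 p2 => [[x1 y1]|] [[x2 y2]|] p1E p2E d1 d2; first last.
- by rewrite /= in d1 d2 *; rewrite d1 d2 addr0.
- by rewrite [w1]d1 add0r.
- by rewrite [w2]d2 addr0.
have [ex|x12] := eqVneq x1 x2; last exact: differential_at_chord.
have [ey|yN] := eqVneq y1 (- y2).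
  rewrite /= ex ey !eqxx /=.
  (* The sum is O, so [w1 + w2] must vanish: the first point is the opposite of the second, and
     uniqueness gives [w1 = - w2]. *)
  have d2' := differential_at_opp d2.
  rewrite ex ey in p1E d1.
  by rewrite (differential_at_uniq p1E d1 d2') addNr.
have ey : y1 = y2.
  move: p1E p2E => /eqP h1 /eqP h2; apply/eqP; rewrite -subr_eq0.
  (* Equal abscissae give equal values of [d y^2], hence ordinates equal up to sign; the opposite
     sign is already excluded. *)
  have : (y1 - y2) * (y1 + y2) == 0.
    rewrite -subr_sqr; apply/eqP/(mulfI nzd).
    by rewrite mulr0 mulrBr h1 h2 ex subrr.
  by rewrite mulf_eq0 [y1 + y2 == 0]addr_eq0 (negPf yN) orbF.
subst x2 y2.
have -> := differential_at_uniq p2E d2 d1.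
apply: differential_at_tangent => //.
by apply: contraNneq yN => ->; rewrite oppr0.
Qed.

Lemma differential_at_mulz (n : int) (p : ec_point E) w :
  differential_at (val p) w -> differential_at (val (ec_mulz n p)) (w *~ n).
Proof.
move=> dp.
have dn k : differential_at (val (iter k (ec_add p) (ec_zero E))) (w *+ k).
  elim: k => [//|k IHk]; rewrite iterS mulrS.
  exact: differential_at_add (valP _) (valP _) dp IHk.
case: n => k; first exact: dn.
exact: differential_at_opp (dn k.+1).
Qed.

(** Additivity carries a relation among the points to the same integral relation among their
    differentials, because the differential at O is 0. *)
Lemma independent_of_differentials r (P : r.-tuple (ec_point E)) (w : 'I_r -> F) :
  (forall i, differential_at (val (tnth P i)) (w i)) ->
  (forall n : 'I_r -> int, \sum_i w i *~ n i = 0 -> forall i, n i = 0) ->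
  ec_independent P.
Proof.
move=> dP w_free n nP0; apply: w_free.
have : differential_at
    (val (\big[@ec_add F E/ec_zero E]_(i < r) ec_mulz (n i) (tnth P i)))
    (\sum_(i < r) w i *~ n i).
  apply: (big_ind2 (fun p z => differential_at (val p) z)) => //.
    by move=> p x q y; apply: differential_at_add (valP p) (valP q).
  by move=> i _; apply: differential_at_mulz.
by rewrite nP0.
Qed.

End InvariantDifferential.

(** * Differentiation of rational functions *)

Section QuotientRule.
Variable F : fieldType.

(** The primed arguments are arbitrary elements, so the laws below are plain field identities,
    available before any derivation of the field exists. *)
Definition quot_rule (p q p' q' : F) : F := (p' * q - p * q') / q ^+ 2.

Lemma quot_rule_wd p q m n p' q' m' n' : q != 0 -> n != 0 ->
  p * n = m * q -> p' * n + p * n' = m' * q + m * q' ->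
  quot_rule p q p' q' = quot_rule m n m' n'.
Proof.
move=> q0 n0 e e'.
have em : m = p * n / q by rewrite e mulfK.
have em' : m' = (p' * n + p * n' - m * q') / q by rewrite e' addrK mulfK.
by rewrite /quot_rule em' em; field; rewrite ?q0 ?n0.
Qed.

Lemma quot_ruleD p q m n p' q' m' n' : q != 0 -> n != 0 ->
  quot_rule (p * n + m * q) (q * n)
    (p' * n + p * n' + (m' * q + m * q')) (q' * n + q * n') =
  quot_rule p q p' q' + quot_rule m n m' n'.
Proof. by move=> q0 n0; rewrite /quot_rule; field; rewrite ?q0 ?n0. Qed.

Lemma quot_ruleM p q m n p' q' m' n' : q != 0 -> n != 0 ->
  quot_rule (p * m) (q * n) (p' * m + p * m') (q' * n + q * n') =
  quot_rule p q p' q' * (m / n) + p / q * quot_rule m n m' n'.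
Proof. by move=> q0 n0; rewrite /quot_rule; field; rewrite ?q0 ?n0. Qed.

End QuotientRule.

Section RationalFunctionDerivation.
Variable k : fieldType.
Local Notation K := {fraction {poly k}}.
Local Notation tofrac := (@tofrac {poly k}).

Lemma frac_repr (x : K) : x = tofrac \n_(repr x) / tofrac \d_(repr x).
Proof.
rewrite -{1}[x]reprK; set r := repr x.
(* Inverse and product are moved to representatives, where the equality already holds before passing
   to the quotient. *)
rewrite /GRing.inv /= /GRing.mul /=; unlock FracField.tofrac.
rewrite -FracField.pi_inv -FracField.pi_mul; congr (\pi_K _)%qT.
rewrite /FracField.mulf /FracField.invf.
by rewrite !numden_Ratio ?oner_eq0 ?denom_ratioP // mulr1 mul1r Ratio_numden.
Qed.

(* Defined on the chosen representative; frac_derivE is independence of it. *)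
Definition frac_deriv (x : K) : K :=
  let p := \n_(repr x) in let q := \d_(repr x) in
  quot_rule (tofrac p) (tofrac q) (tofrac p^`()) (tofrac q^`()).

Lemma frac_derivE (p q : {poly k}) : q != 0 ->
  frac_deriv (tofrac p / tofrac q) =
  quot_rule (tofrac p) (tofrac q) (tofrac p^`()) (tofrac q^`()).
Proof.
move=> q0; have := frac_repr (tofrac p / tofrac q).
rewrite /frac_deriv; move: (repr _) => r; have := denom_ratioP r.
move: (\n_r) (\d_r) => m n /= n0 /eqP.
rewrite eqr_div ?tofrac_eq0 // -!tofracM tofrac_eq => /eqP e.
apply: quot_rule_wd; rewrite ?tofrac_eq0 // -!tofracM ?e // -!tofracD.
by rewrite -!derivM e.
Qed.

Lemma frac_deriv_poly (p : {poly k}) : frac_deriv (tofrac p) = tofrac p^`().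
Proof.
rewrite -[tofrac p]divr1 -tofrac1 frac_derivE ?oner_eq0 // /quot_rule.
by rewrite derivC tofrac0 tofrac1 mulr1 mulr0 subr0 expr1n divr1.
Qed.

Lemma frac_derivD x y : frac_deriv (x + y) = frac_deriv x + frac_deriv y.
Proof.
rewrite [x]frac_repr [y]frac_repr.
have := denom_ratioP (repr x); have := denom_ratioP (repr y).
move: (\n_(repr x)) (\d_(repr x)) (\n_(repr y)) (\d_(repr y)) => p q m n n0 q0.
rewrite addf_div ?tofrac_eq0 // -!tofracM -tofracD !frac_derivE ?mulf_neq0 //.
rewrite !(derivD, derivM, tofracD, tofracM).
by apply: quot_ruleD; rewrite tofrac_eq0.
Qed.

Lemma frac_derivM x y : frac_deriv (x * y) =
  frac_deriv x * y + x * frac_deriv y.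
Proof.
rewrite [x]frac_repr [y]frac_repr.
have := denom_ratioP (repr x); have := denom_ratioP (repr y).
move: (\n_(repr x)) (\d_(repr x)) (\n_(repr y)) (\d_(repr y)) => p q m n n0 q0.
rewrite mulf_div -!tofracM !frac_derivE ?mulf_neq0 //.
rewrite !(derivD, derivM, tofracD, tofracM).
by apply: quot_ruleM; rewrite tofrac_eq0.
Qed.

Definition frac_derivation : derivation K :=
  Derivation frac_derivD frac_derivM.

End RationalFunctionDerivation.

(** * The three points and their differentials, over a field with [D t = 1] *)

Section TwistPoints.
Variables (F : fieldType) (D : derivation F) (t : F).
Hypothesis char0 : forall n, n.+1%:R != 0 :> F.
Hypotheses (t0 : t != 0) (tD : t ^+ 2 + 1 != 0) (tB : t ^+ 2 - 1 != 0).
Hypothesis Dt : D t = 1.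

Let x1 := - ((t ^+ 4 - 6 * t ^+ 2 + 1) / (3 * (t ^+ 2 + 1) ^+ 2)).
Let y1 := 2 / (9 * (t ^+ 2 + 1) ^+ 3).
Let x2 := - ((t ^+ 4 + 6 * t ^+ 2 + 1) / (3 * (t ^+ 2 - 1) ^+ 2)).
Let y2 := 2 / (9 * (t ^+ 2 - 1) ^+ 3).
Let x3 := (t ^+ 4 + 1) / (6 * t ^+ 2).
Let y3 := 1 / (36 * t ^+ 3).
Local Notation d := (6 * (t ^+ 12 - 33 * t ^+ 8 - 33 * t ^+ 4 + 1)).

(** The coefficients [-1] and [0] stay visible so that the equation is convertible to membership in
    [twist_curve]. *)
Lemma twist_point1 : d * y1 ^+ 2 = x1 ^+ 3 + -1 * x1 + 0.
Proof. by rewrite /x1 /y1; field; rewrite ?tD ?char0. Qed.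

Lemma twist_point2 : d * y2 ^+ 2 = x2 ^+ 3 + -1 * x2 + 0.
Proof. by rewrite /x2 /y2; field; rewrite ?tB ?char0. Qed.

Lemma twist_point3 : d * y3 ^+ 2 = x3 ^+ 3 + -1 * x3 + 0.
Proof. by rewrite /x3 /y3; field; rewrite ?t0 ?char0. Qed.

Lemma twist_ord1_neq0 : y1 != 0.
Proof. by rewrite !(mulf_neq0, invr_neq0, expf_neq0) ?char0. Qed.

Lemma twist_ord2_neq0 : y2 != 0.
Proof. by rewrite !(mulf_neq0, invr_neq0, expf_neq0) ?char0. Qed.

Lemma twist_ord3_neq0 : y3 != 0.
Proof. by rewrite !(mulf_neq0, invr_neq0, expf_neq0) ?oner_eq0 ?char0. Qed.

(** This exhibits w(P1) as the factor in front of [y1]; as [y1] is nonzero, [differential_at_affine]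
    supplies the other equation. *)
Lemma twist_der1 : D x1 = 24 * (t - t ^+ 3) * y1.
Proof.
rewrite derN der_div ?mulf_neq0 ?expf_neq0 ?char0 //.
rewrite !(derD, derN) ![D (_%:R * _)]derM
  !(derX, derD, derN, Dt, der_nat, der1) /y1 /=.
by field; rewrite ?tD ?char0.
Qed.

Lemma twist_der2 : D x2 = 24 * (t + t ^+ 3) * y2.
Proof.
rewrite derN der_div ?mulf_neq0 ?expf_neq0 ?char0 //.
rewrite !(derD, derN) ![D (_%:R * _)]derM
  !(derX, derD, derN, Dt, der_nat, der1) /y2 /=.
by field; rewrite ?tB ?char0.
Qed.

Lemma twist_der3 : D x3 = 12 * (t ^+ 4 - 1) * y3.
Proof.
rewrite der_div ?mulf_neq0 ?expf_neq0 ?char0 //.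
rewrite !(derD, derN) ![D (_%:R * _)]derM
  !(derX, derD, derN, Dt, der_nat, der1) /y3 /=.
by field; rewrite ?t0 ?char0.
Qed.

End TwistPoints.

(** * Passage to Q(u) and linear independence of the differentials *)

Lemma horner_frac_neq0 (p : {poly rat}) (c : rat) : p.[c] != 0 -> tofrac p != 0.
Proof. by rewrite tofrac_eq0; apply: contraNneq => ->; rewrite horner0. Qed.

Lemma u_neq0 : u != 0.
Proof. by rewrite (@horner_frac_neq0 _ 1) // hornerX oner_eq0. Qed.

Lemma u2D1_neq0 : u ^+ 2 + 1 != 0.
Proof.
rewrite -tofracXn -tofrac1 -tofracD (@horner_frac_neq0 _ 0) //.
by rewrite !hornerE.
Qed.

Lemma u2B1_neq0 : u ^+ 2 - 1 != 0.
Proof.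
rewrite -tofracXn -tofrac1 -tofracB (@horner_frac_neq0 _ 0) //.
by rewrite !hornerE.
Qed.

(** The differentials of the three points, taken as polynomials so that coefficients can be
    compared. *)
Definition omega (i : 'I_3) : {poly rat} :=
  [:: ('X - 'X^3) *+ 24; ('X + 'X^3) *+ 24; ('X^4 - 1) *+ 12]`_i.

Lemma omega_free (n : 'I_3 -> int) :
  \sum_i omega i *~ n i = 0 -> forall i, n i = 0.
Proof.
rewrite !big_ord_recl big_ord0 addr0 /omega /=.
set n0 := n _; set n1 := n _; set n2 := n _ => e.
have c j := congr1 (coefp j) e.
(* Degree 0 isolates [n2]; degrees 1 and 3 give [n0 + n1 = 0] and [n1 - n0 = 0]. *)
have := c 0; have := c 1; have := c 3%N.
rewrite /= !coefD !coefMrz !(coefMn, coefB, coefD, coefN, coefXn, coefX, coef1).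
rewrite /= !coef0 => c3 c1 c0.
have z0 : n0 = 0 by apply/eqP; rewrite -(intr_eq0 rat); apply/eqP; lra.
have z1 : n1 = 0 by apply/eqP; rewrite -(intr_eq0 rat); apply/eqP; lra.
have z2 : n2 = 0 by apply/eqP; rewrite -(intr_eq0 rat); apply/eqP; lra.
case=> [[|[|[|//]]] lti]; [rewrite -z0 | rewrite -z1 | rewrite -z2];
  by congr n; apply: val_inj.
Qed.

Theorem theorem4p5 :
  ec_rank_ge twist_curve 3 /\
  exists P1 P2 P3 : ec_point twist_curve,
    [/\ val P1 = Some (- ((u ^+ 4 - 6 * u ^+ 2 + 1) / (3 * (u ^+ 2 + 1) ^+ 2)),
                       2 / (9 * (u ^+ 2 + 1) ^+ 3)),
        val P2 = Some (- ((u ^+ 4 + 6 * u ^+ 2 + 1) / (3 * (u ^+ 2 - 1) ^+ 2)),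
                       2 / (9 * (u ^+ 2 - 1) ^+ 3)),
        val P3 = Some ((u ^+ 4 + 1) / (6 * u ^+ 2), 1 / (36 * u ^+ 3))
      & ec_independent [tuple P1; P2; P3]].

Proof.
have char0 := natr_Qu_neq0.
have Du : frac_derivation rat u = 1 by rewrite /= frac_deriv_poly derivX tofrac1.
have Da : frac_derivation rat (ec_a twist_curve) = 0 by rewrite derN der1 oppr0.
have Db : frac_derivation rat (ec_b twist_curve) = 0 by exact: der0.
have on1 := introT eqP (twist_point1 char0 u2D1_neq0).
have on2 := introT eqP (twist_point2 char0 u2B1_neq0).
have on3 := introT eqP (twist_point3 char0 u_neq0).
pose P1 : ec_point twist_curve := exist (on_curve twist_curve) (Some (_, _)) on1.
pose P2 : ec_point twist_curve := exist (on_curve twist_curve) (Some (_, _)) on2.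
pose P3 : ec_point twist_curve := exist (on_curve twist_curve) (Some (_, _)) on3.
have d1 := differential_at_affine Da Db on1 (twist_ord1_neq0 char0 u2D1_neq0)
  (twist_der1 char0 u2D1_neq0 Du).
have d2 := differential_at_affine Da Db on2 (twist_ord2_neq0 char0 u2B1_neq0)
  (twist_der2 char0 u2B1_neq0 Du).
have d3 := differential_at_affine Da Db on3 (twist_ord3_neq0 char0 u_neq0)
  (twist_der3 char0 u_neq0 Du).
have indep : ec_independent [tuple P1; P2; P3].
  pose w i : Qu := tofrac (omega i).
  apply: (independent_of_differentials Da (w := w)).
  - have tX m : tofrac ('X^m : {poly rat}) = u ^+ m by rewrite tofracXn.
    have w1 : tofrac (('X - 'X^3) *+ 24) = 24 * (u - u ^+ 3).
      by rewrite tofracMn tofracB tX mulr_natl.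
    have w2 : tofrac (('X + 'X^3) *+ 24) = 24 * (u + u ^+ 3).
      by rewrite tofracMn tofracD tX mulr_natl.
    have w3 : tofrac (('X^4 - 1) *+ 12) = 12 * (u ^+ 4 - 1).
      by rewrite tofracMn tofracB tX tofrac1 mulr_natl.
    case=> [[|[|[|//]]] lti]; rewrite (tnth_nth P1) /w /omega [nth _ _ _]/=.
    + by rewrite w1; exact: d1.
    + by rewrite w2; exact: d2.
    + by rewrite w3; exact: d3.
  (* [tofrac] is injective and additive, so a relation in Q(u) comes from one between the
     polynomials [omega i]. *)
  - move=> n e; apply: omega_free; apply/eqP; rewrite -tofrac_eq0.
    have ew : tofrac (\sum_i omega i *~ n i) = \sum_i w i *~ n i.
      by rewrite raddf_sum; apply: eq_bigr => i _; rewrite raddfMz.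
    by rewrite ew e.
split; first by exists [tuple P1; P2; P3].
by exists P1, P2, P3.
Qed.
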